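(* For all positive integers $m\leqslant n$, the complete bipartite graph $K_{m,n}$ belongs to $B_{2m-2}^{m}$, i.e. $K_{m,n}$ has a monotonic $(2m-2)$-bend EPG representation. (In the symbol $B_{\ell}^{m}$ the superscript $m$ stands for ''monotonic'' and is not the integer $m$.)
   Context: All graphs are finite and simple. $K_{m,n}$ is the complete bipartite graph with partition classes of sizes $m$ and $n$. A grid consists of horizontal grid lines (rows, increasing from bottom to top) and vertical grid lines (columns, increasing from left to right). A grid point is a crossing of two grid lines. A grid edge is the part of a grid line between two consecutive grid points. A path on a grid consists of two grid points (its end points) and a number of consecutive grid edges connecting them. A bend of a path is a turn of the path at a grid point. An EPG representation of a graph $G$ assigns to each vertex $v$ of $G$ a path $P_v$ on a common grid such that two distinct vertices $v,w$ are adjacent in $G$ if and only if $P_v$ and $P_w$ share at least one grid edge. A path is monotonic if it is ascending in both columns and rows, i.e. it has the shape of a staircase going upwards from left to right. For a nonnegative integer $\ell$, $B_\ell^m$ (the superscript $m$ is just a symbol for ''monotonic'') is the class of all graphs that have an EPG representation in which every path is monotonic and has at most $\ell$ bends. *)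

(* Defs.v *)
From mathcomp Require Import all_boot.

Set Implicit Arguments.
Unset Strict Implicit.
Unset Printing Implicit Defensive.

Record sgraph := SGraph {
  vertex :> finType;
  adj : rel vertex;
  adj_sym : symmetric adj;
  adj_irr : irreflexive adj
}.

Definition Kmn_adj (m n : nat) : rel ('I_m + 'I_n) :=
  fun u v => match u, v with
             | inl _, inr _ | inr _, inl _ => true
             | _, _ => false
             end.

Lemma Kmn_sym (m n : nat) : symmetric (@Kmn_adj m n).
Proof. by move=> [i|i] [j|j]. Qed.

Lemma Kmn_irr (m n : nat) : irreflexive (@Kmn_adj m n).
Proof. by move=> [i|i]. Qed.

Definition complete_bipartite (m n : nat) : sgraph :=
  SGraph (@Kmn_sym m n) (@Kmn_irr m n).

(* The point (x, y) is the crossing of column x and row y. *)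
Definition point : Type := (nat * nat)%type.

Definition in_grid (c r : nat) (a : point) : bool := (a.1 < c) && (a.2 < r).

Definition step_right (a b : point) : bool := (b.1 == a.1.+1) && (b.2 == a.2).
Definition step_up (a b : point) : bool := (b.1 == a.1) && (b.2 == a.2.+1).
Definition ascending_step (a b : point) : bool := step_right a b || step_up a b.

Definition grid_adj (a b : point) : bool :=
  ascending_step a b || ascending_step b a.

(* A path is given by the sequence of the grid points that it visits; it has
   at least one edge, so that its two end points are distinct. *)
Definition grid_path (c r : nat) (p : seq point) : bool :=
  [&& 1 < size p, all (in_grid c r) p, sorted grid_adj p & uniq p].

(* The points of a monotonic path are listed from its lower left end point. *)
Definition monotonic (p : seq point) : bool := sorted ascending_step p.

Definition horizontal (a b : point) : bool := a.2 == b.2.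

Definition turn (a b c : point) : bool := horizontal a b != horizontal b c.

Fixpoint bends (p : seq point) : nat :=
  match p with
  | a :: ((b :: c :: _) as q) => turn a b c + bends q
  | _ => 0
  end.

(* Grid edges are unordered pairs of consecutive points. *)
Definition has_edge (p : seq point) (a b : point) : bool :=
  let steps := zip p (behead p) in ((a, b) \in steps) || ((b, a) \in steps).

Definition share_edge (p q : seq point) : Prop :=
  exists a b : point, has_edge p a b /\ has_edge q a b.

Definition EPG_representation (G : sgraph) (c r : nat)
    (P : G -> seq point) : Prop :=
  (forall v : G, grid_path c r (P v)) /\
  (forall v w : G, v <> w -> (adj v w <-> share_edge (P v) (P w))).

(* The class $B_l^m$, where m stands for monotonic. *)
Definition Bmonotonic (l : nat) (G : sgraph) : Prop :=
  exists (c r : nat) (P : G -> seq point),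
    EPG_representation c r P /\
    (forall v : G, monotonic (P v) /\ bends (P v) <= l).

(* Main.v *)
Require Import Defs.
From mathcomp Require Import all_boot.
From mathcomp Require Import zify.

(** The [m] vertices of the first class are the rows [0, ..., m-1] themselves,
    as straight paths.  The [j]-th vertex of the second class is the unit
    staircase that starts at [(j, 0)] with a horizontal edge and ends with a
    horizontal edge in row [m-1]: it takes one edge of each row and turns at
    each of its [2m-2] inner points.  Distinct staircases are horizontal
    translates of each other and have one edge in each row and in each gap
    between rows, so they are edge-disjoint. *)

Lemma ascending_step_rank {a b} : ascending_step a b -> b.1 + b.2 = (a.1 + a.2).+1.
Proof. by case/orP=> /andP[/eqP-> /eqP->]; rewrite ?addSn ?addnS. Qed.

(** The coordinate sum grows by one with each step, so no point recurs. *)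
Lemma monotonic_uniq {p} : monotonic p -> uniq p.
Proof.
move=> mono; apply: (@map_uniq _ _ (fun a => a.1 + a.2)).
apply: (sorted_uniq ltn_trans ltnn); rewrite sorted_map.
by apply: sub_sorted mono => a b /ascending_step_rank /= ->.
Qed.

Lemma monotonic_grid_path {c r p} :
  1 < size p -> all (in_grid c r) p -> monotonic p -> grid_path c r p.
Proof.
move=> szp inp mono; rewrite /grid_path szp inp monotonic_uniq // andbT.
by apply: sub_sorted mono => a b ab; apply/orP; left.
Qed.

Lemma monotonic_mkseq {f N} :
  (forall k, ascending_step (f k) (f k.+1)) -> monotonic (mkseq f N).
Proof.
move=> asc; apply/(sortedP (f 0)) => k; rewrite size_mkseq => ltkN.
by rewrite !nth_mkseq // ltnW.
Qed.

Lemma has_edge_mkseqP {f : nat -> point} {N a b} :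
  has_edge (mkseq f N.+1) a b <->
  exists2 k, k < N & (a, b) = (f k, f k.+1) \/ (b, a) = (f k, f k.+1).
Proof.
(* The start [k] is arbitrary so that the induction on [n] can shift it. *)
have steps n k : zip (map f (iota k n.+1)) (map f (iota k.+1 n)) =
    [seq (f i, f i.+1) | i <- iota k n].
  by elim: n k => //= n IH k; rewrite -IH.
rewrite /has_edge [behead _]/= steps; split.
  by case/orP=> /mapP[k]; rewrite mem_iota => ltkN ->; exists k; auto.
move=> [k ltkN [->|->]]; apply/orP; [left|right];
  by apply/mapP; exists k; rewrite // mem_iota.
Qed.

Lemma share_edge_mkseqP {f g : nat -> point} {M N} :
    (forall k, ascending_step (f k) (f k.+1)) ->
    (forall k, ascending_step (g k) (g k.+1)) ->
  share_edge (mkseq f M.+1) (mkseq g N.+1) <->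
  exists k l, [/\ k < M, l < N, f k = g l & f k.+1 = g l.+1].
Proof.
move=> ascf ascg; split; last first.
  move=> [k [l [ltkM ltlN e1 e2]]]; exists (f k), (f k.+1).
  split; apply/has_edge_mkseqP; first by exists k; auto.
  by exists l; rewrite // e1 e2; auto.
move=> [a [b [/has_edge_mkseqP[k ltkM ef] /has_edge_mkseqP[l ltlN eg]]]].
exists k, l; have /= := ascending_step_rank (ascf k).
have /= := ascending_step_rank (ascg l).
(* Coordinate sums rule out the two cases in which the paths would traverse the edge in opposite
   directions. *)
by case: ef eg => [] [<- <-] [] [<- <-] //; lia.
Qed.

(** A path can turn only at its inner points. *)
Lemma bends_le_size p : bends p <= size p - 2.
Proof.
elim: p => [|a [|b [|c p]] IH] //=.
rewrite !subSS subn0 in IH *; rewrite -[(size p).+1]add1n.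
exact: leq_add (leq_b1 _) IH.
Qed.

Lemma bends_row y p : all (fun a => a.2 == y) p -> bends p = 0.
Proof.
elim: p => [|a [|b [|c p]] IH] // /andP[/eqP ay ryp].
have /and3P[/eqP by_ /eqP cy _] := ryp.
by rewrite -(IH ryp) /= /turn /horizontal ay by_ cy eqxx.
Qed.

Definition row_point (i k : nat) : point := (k, i).

(** Steps alternate right, up, beginning with right: [uphalf k] of the first [k] go right, [k./2] go
    up. *)
Definition stair_point (j k : nat) : point := (j + uphalf k, k./2).

Lemma row_point_ascending i k :
  ascending_step (row_point i k) (row_point i k.+1).
Proof. by rewrite /ascending_step /step_right !eqxx. Qed.

Lemma stair_point_ascending j k :
  ascending_step (stair_point j k) (stair_point j k.+1).
Proof.
by rewrite /ascending_step /step_right /step_up /stair_point /= !uphalfE /=; lia.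
Qed.

(** A staircase has [m] right and [m - 1] up steps; the last one ends in column [n - 1 + m], within
    reach of the rows. *)
Definition Kmn_path {m n : nat} (v : complete_bipartite m n) : seq point :=
  match v with
  | inl i => mkseq (row_point i) (m + n).+1
  | inr j => mkseq (stair_point j) (2 * m - 1).+1
  end.

Lemma Kmn_path_monotonic {m n} (v : complete_bipartite m n) :
  monotonic (Kmn_path v).
Proof.
case: v => i; apply: monotonic_mkseq.
  exact: row_point_ascending.
exact: stair_point_ascending.
Qed.

Lemma Kmn_path_bends {m n} (v : complete_bipartite m n) :
  bends (Kmn_path v) <= 2 * m - 2.
Proof.
case: v => i; last by apply: leq_trans (bends_le_size _) _; rewrite size_mkseq; lia.
rewrite (bends_row i) //; apply/allP => _ /mapP[k _ ->]; exact: eqxx.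
Qed.

Lemma Kmn_path_grid {m n} (v : complete_bipartite m n) :
  0 < m -> grid_path (m + n).+1 m (Kmn_path v).
Proof.
move=> m_gt0; apply: monotonic_grid_path (Kmn_path_monotonic v).
  by case: v => i; rewrite size_mkseq; lia.
apply/allP; case: v => i _ /mapP[k + ->]; have := ltn_ord i;
  by rewrite mem_iota /in_grid /= ?uphalfE; lia.
Qed.

Lemma share_edge_sym {p q} : share_edge p q -> share_edge q p.
Proof. by move=> [a [b [? ?]]]; exists a, b. Qed.

Lemma share_edge_row_stair {m n} (i : 'I_m) (j : 'I_n) :
  share_edge (Kmn_path (inl i : complete_bipartite m n))
             (Kmn_path (inr j : complete_bipartite m n)).
Proof.
apply/(share_edge_mkseqP (row_point_ascending i) (stair_point_ascending j)).
have := ltn_ord i; have := ltn_ord j.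
(* Staircase [j] enters row [i] after [i] right and [i] up steps, at column [j + i], and its next
   step goes right. *)
exists (j + i), i.*2; rewrite /row_point /stair_point /= !uphalf_double !doubleK.
by split; rewrite ?addnS //; lia.
Qed.

Lemma Kmn_path_adj {m n} (v w : complete_bipartite m n) : v <> w ->
  adj v w <-> share_edge (Kmn_path v) (Kmn_path w).
Proof.
case: v w => [i|j] [i'|j'] vDw; split=> //=.
- move/(share_edge_mkseqP (row_point_ascending i) (row_point_ascending i')).
  by move=> [k [l [_ _ [_ /ord_inj eq_i] _]]]; case: vDw; rewrite eq_i.
- by move=> _; exact: share_edge_row_stair.
- by move=> _; exact/share_edge_sym/share_edge_row_stair.
- move/(share_edge_mkseqP (stair_point_ascending j) (stair_point_ascending j')).
  (* The row [k.+1./2] of the edge's upper right end is [uphalf k], the column offset of its other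
     end; so [e2] cancels the offsets in [e1]. *)
  move=> [k [l [_ _ [e1 _] [_ e2]]]]; case: vDw.
  by rewrite -e2 in e1; move/addIn/ord_inj: e1 => ->.
Qed.

Theorem theorem2p7 (m n : nat) (hm : 0 < m) (hmn : m <= n) :
  Bmonotonic (2 * m - 2) (complete_bipartite m n).
Proof.
exists (m + n).+1, m, (@Kmn_path m n); split; split.
- by move=> v; exact: Kmn_path_grid.
- exact: Kmn_path_adj.
- exact: Kmn_path_monotonic.
- exact: Kmn_path_bends.
Qed.
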